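(* Let $\tau\geq 1$, let $f_t:\mathbb{R}^{n_x}\times\mathbb{R}^{n_u}\to\mathbb{R}^{n_x}$ ($0\le t\le \tau-1$), $h_t:\mathbb{R}^{n_x}\times\mathbb{R}^{n_u}\to\mathbb{R}$ ($0\le t\le\tau-1$) and $h_\tau:\mathbb{R}^{n_x}\to\mathbb{R}$ be twice differentiable, and let $\bar x_0\in\mathbb{R}^{n_x}$. Consider the nonlinear dynamical problem $$\min_{\boldsymbol u\in\mathbb{R}^{\tau n_u}} (h\circ g)(\boldsymbol u),\qquad h(\boldsymbol x,\boldsymbol u)=\sum_{t=0}^{\tau-1}h_t(x_t,u_t)+h_\tau(x_\tau),\qquad g(\boldsymbol u)=(f^{[\tau]}(\bar x_0,\boldsymbol u),\boldsymbol u),$$ where $\boldsymbol x=(x_1;\ldots;x_\tau)$, $\boldsymbol u=(u_0;\ldots;u_{\tau-1})$, $x_0=\bar x_0$, and $f^{[\tau]}$ is the control of the $\tau$ dynamics $(f_t)_{t=0}^{\tau-1}$. Let $\boldsymbol u=(u_0;\ldots;u_{\tau-1})\in\mathbb{R}^{\tau n_u}$ and $f^{[\tau]}(\bar x_0,\boldsymbol u)=(x_1;\ldots;x_\tau)$, with $x_0=\bar x_0$. Then computing the gradient oracle (with regularization $\nu>0$), the Gauss-Newton oracle (with $\nu\geq0$) or the Newton oracle (with $\nu\ge 0$) for $h\circ g$ at $\boldsymbol u$ amounts to solving for $\boldsymbol v^*=(v_0^*;\ldots;v_{\tau-1}^* )$ a linear quadratic control problem of the form $$\min_{\substack{v_0,\ldots,v_{\tau-1}\in\mathbb{R}^{n_u}\\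 y_0,\ldots,y_\tau\in\mathbb{R}^{n_x}}}\ \sum_{t=0}^{\tau-1}q_t(y_t,v_t)+q_\tau(y_\tau)\quad\text{subject to}\quad y_{t+1}=\ell_{f_t}^{x_t,u_t}(y_t,v_t)\ \text{ for } t\in\{0,\ldots,\tau-1\},\quad y_0=0;$$ that is, $\boldsymbol v^*$ is a minimizer of the problem defining the oracle if and only if $\boldsymbol v^*$ is the control part of a solution of this linear quadratic control problem, where: (i) for the gradient oracle, $q_\tau(y_\tau)=\ell_{h_\tau}^{x_\tau}(y_\tau)$ and, for $0\le t\le\tau-1$, $$q_t(y_t,v_t)=\ell_{h_t}^{x_t,u_t}(y_t,v_t)+\frac{\nu}{2}\|v_t\|_2^2;$$ (ii) for the Gauss-Newton oracle, $q_\tau(y_\tau)=q_{h_\tau}^{x_\tau}(y_\tau)$ and, for $0\le t\le\tau-1$, $$q_t(y_t,v_t)=q_{h_t}^{x_t,u_t}(y_t,v_t)+\frac{\nu}{2}\|v_t\|_2^2;$$ (iii) for the Newton oracle, $q_\tau(y_\tau)=q_{h_\tau}^{x_\tau}(y_\tau)$ and, defining $$\lambda_\tau=\nabla h_\tau(x_\tau),\qquad \lambda_t=\nabla_{x_t}h_t(x_t,u_t)+\nabla_{x_t}f_t(x_t,u_t)\lambda_{t+1}\quad\text{for } t\in\{\tau-1,\ldots,1\},$$ we have, for $0\le t\le\tau-1$, $$q_t(y_t,v_t)=q_{h_t}^{x_t,u_t}(y_t,v_t)+\frac12\nabla^2f_t(x_t,u_t)[\cdot,\cdot,\lambda_{t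+1}](y_t,v_t)+\frac{\nu}{2}\|v_t\|_2^2.$$
   Context: Semicolons denote concatenation of vectors. Control of dynamics: the control of $\tau$ discrete time dynamics $(f_t:\mathbb{R}^{n_x}\times\mathbb{R}^{n_u}\to\mathbb{R}^{n_x})_{t=0}^{\tau-1}$ is the function $f^{[\tau]}:\mathbb{R}^{n_x}\times\mathbb{R}^{\tau n_u}\to\mathbb{R}^{\tau n_x}$ which, given $x_0$ and $\boldsymbol u=(u_0;\ldots;u_{\tau-1})$, outputs $f^{[\tau]}(x_0,\boldsymbol u)=(x_1;\ldots;x_\tau)$ with $x_{t+1}=f_t(x_t,u_t)$ for $t\in\{0,\ldots,\tau-1\}$. Derivatives: for $f:\mathbb{R}^d\to\mathbb{R}^n$, $\nabla f(x)=(\partial_{x_i}f_j(x))_{1\le i\le d,1\le j\le n}\in\mathbb{R}^{d\times n}$ is the transpose of the Jacobian; for $f:\mathbb{R}^d\times\mathbb{R}^p\to\mathbb{R}^n$, $\nabla_xf(x,y)\in\mathbb{R}^{d\times n}$ is the partial transposed Jacobian with respect to $x$ (similarly for $y$). The Hessian is the tensor $\nabla^2f(x)=(\nabla^2f_1(x),\ldots,\nabla^2f_n(x))\in\mathbb{R}^{d\times d\times n}$, and partial Hessians such as $\nabla^2_{xy}f(x,y)=(\nabla^2_{xy}f_1(x,y),\ldots,\nabla^2_{xy}f_n(x,y))\in\mathbb{R}^{d\times p\times n}$ are defined similarly. Tensor notation: for $\mathcal A=(A_1,\ldots,A_n)$ with $A_k\in\mathbb{R}^{d\times p}$, and $a\in\mathbb{R}^d$,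 $b\in\mathbb{R}^p$, $z\in\mathbb{R}^n$: $\mathcal A[a,b,\cdot]=(a^\top A_1b,\ldots,a^\top A_nb)^\top\in\mathbb{R}^n$ and $\mathcal A[a,b,z]=\sum_{k=1}^nz_k\,a^\top A_kb$. Expansions: for $f:\mathbb{R}^d\to\mathbb{R}^n$ and $x\in\mathbb{R}^d$, the linear and quadratic expansions of $f$ around $x$ (without constant term) are $\ell_f^x(y)=\nabla f(x)^\top y$ and $q_f^x(y)=\nabla f(x)^\top y+\frac12\nabla^2f(x)[y,y,\cdot]$. For functions of two variables $(x,u)$, $\ell_f^{x,u}(y,v)$ and $q_f^{x,u}(y,v)$ denote these expansions with respect to the joint variable $(x,u)$; e.g. $\ell_f^{x,u}(y,v)=\nabla_xf(x,u)^\top y+\nabla_uf(x,u)^\top v$. For $f:\mathbb{R}^{n_x}\times\mathbb{R}^{n_u}\to\mathbb{R}^{n_x}$, $x\in\mathbb{R}^{n_x}$, $u\in\mathbb{R}^{n_u}$, $\lambda\in\mathbb{R}^{n_x}$, the quadratic form $\nabla^2f(x,u)[\cdot,\cdot,\lambda]$ is $$(y,v)\mapsto\nabla^2_{xx}f(x,u)[y,y,\lambda]+2\nabla^2_{xu}f(x,u)[y,v,\lambda]+\nabla^2_{uu}f(x,u)[v,v,\lambda].$$ Oracles for $h\circ g$ at $\boldsymbol u$ with regularization $\nu$: the gradient oracle ($\nu>0$) outputs $\operatorname{arg\,min}_{\boldsymbol v\in\mathbb{R}^{\tau n_u}}\{\ell_{h\circ g}^{\boldsymbol u}(\boldsymbol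 v)+\frac{\nu}{2}\|\boldsymbol v\|_2^2\}$; the Gauss-Newton oracle ($\nu\ge0$) outputs $\operatorname{arg\,min}_{\boldsymbol v\in\mathbb{R}^{\tau n_u}}\{q_h^{g(\boldsymbol u)}(\ell_g^{\boldsymbol u}(\boldsymbol v))+\frac{\nu}{2}\|\boldsymbol v\|_2^2\}$; the Newton oracle ($\nu\ge0$) outputs $\operatorname{arg\,min}_{\boldsymbol v\in\mathbb{R}^{\tau n_u}}\{q_{h\circ g}^{\boldsymbol u}(\boldsymbol v)+\frac{\nu}{2}\|\boldsymbol v\|_2^2\}$. *)

(* Defs.v *)
From mathcomp Require Import all_boot all_order all_algebra.
From mathcomp Require Import all_classical all_reals all_analysis.

Set Implicit Arguments.
Unset Strict Implicit.
Unset Printing Implicit Defensive.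

Import Order.TTheory GRing.Theory Num.Theory.
Import numFieldNormedType.Exports.

Local Open Scope ring_scope.

(* Conventions. The vectors of R^d are the row vectors 'rV[R]_d, so that the
   product (nabla f(x))^T y of the column convention reads y *m grad f x.
   The concatenation of two vectors is row_mx. A concatenation
   (z_0; ...; z_(tau-1)) of tau vectors of R^n is a vector of 'rV_(tau * n),
   namely mxvec of the matrix whose rows are the z_t. *)

Section Derivatives.
Variable R : realType.

Definition pd d (W : normedModType R) (i : 'I_d) (f : 'rV[R]_d -> W)
    (x : 'rV[R]_d) : W :=
  'D_(delta_mx 0 i) f x.

Definition sgrad d (phi : 'rV[R]_d -> R) (x : 'rV[R]_d) : 'rV[R]_d :=
  \row_i pd i phi x.

Definition grad d n (f : 'rV[R]_d -> 'rV[R]_n) (x : 'rV[R]_d) : 'M[R]_(d, n) :=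
  \matrix_(i, j) pd i (fun z => f z 0 j) x.

Definition hess d (phi : 'rV[R]_d -> R) (x : 'rV[R]_d) : 'M[R]_d :=
  \matrix_(i, j) pd i (pd j phi) x.

Definition twice_differentiable_scalar d (phi : 'rV[R]_d -> R) : Prop :=
  forall x, differentiable phi x /\ differentiable (sgrad phi) x.

Definition twice_differentiable d n (f : 'rV[R]_d -> 'rV[R]_n) : Prop :=
  forall x, differentiable f x /\ differentiable (grad f) x.

Definition bilin d p (A : 'M[R]_(d, p)) (a : 'rV[R]_d) (b : 'rV[R]_p) : R :=
  (a *m A *m b^T) 0 0.

(* A[a, b, z] for the tensor A = (A_1, ..., A_n) *)
Definition tensor d p n (A : 'I_n -> 'M[R]_(d, p))
    (a : 'rV[R]_d) (b : 'rV[R]_p) (z : 'rV[R]_n) : R :=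
  \sum_k z 0 k * bilin (A k) a b.

(* The expansions are without constant term; lin and quad are for
   real-valued functions, vlin for vector-valued ones. *)
Definition lin d (phi : 'rV[R]_d -> R) (x y : 'rV[R]_d) : R :=
  \sum_i pd i phi x * y 0 i.

Definition quad d (phi : 'rV[R]_d -> R) (x y : 'rV[R]_d) : R :=
  lin phi x y + 2^-1 * bilin (hess phi x) y y.

Definition vlin d n (f : 'rV[R]_d -> 'rV[R]_n) (x y : 'rV[R]_d) : 'rV[R]_n :=
  y *m grad f x.

(* The norm `|v| of the library on 'rV_d is the sup norm, hence this. *)
Definition sqnorm d (v : 'rV[R]_d) : R := \sum_i v 0 i ^+ 2.

Definition joint d p (T : Type) (f : 'rV[R]_d -> 'rV[R]_p -> T)
    (z : 'rV[R]_(d + p)) : T :=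
  f (lsubmx z) (rsubmx z).

Definition lin2 d p (phi : 'rV[R]_d -> 'rV[R]_p -> R) x u y v : R :=
  lin (joint phi) (row_mx x u) (row_mx y v).

Definition quad2 d p (phi : 'rV[R]_d -> 'rV[R]_p -> R) x u y v : R :=
  quad (joint phi) (row_mx x u) (row_mx y v).

Definition vlin2 d p n (f : 'rV[R]_d -> 'rV[R]_p -> 'rV[R]_n) x u y v :
    'rV[R]_n :=
  vlin (joint f) (row_mx x u) (row_mx y v).

Definition hess_xx d p n (f : 'rV[R]_d -> 'rV[R]_p -> 'rV[R]_n) x u (k : 'I_n) :
    'M[R]_d :=
  hess (fun x' => f x' u 0 k) x.

Definition hess_xu d p n (f : 'rV[R]_d -> 'rV[R]_p -> 'rV[R]_n) x u (k : 'I_n) :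
    'M[R]_(d, p) :=
  \matrix_(i, j) pd i (fun x' => pd j (fun u' => f x' u' 0 k) u) x.

Definition hess_uu d p n (f : 'rV[R]_d -> 'rV[R]_p -> 'rV[R]_n) x u (k : 'I_n) :
    'M[R]_p :=
  hess (fun u' => f x u' 0 k) u.

(* the quadratic form nabla^2 f(x, u)[., ., lam] *)
Definition hess_form d p n (f : 'rV[R]_d -> 'rV[R]_p -> 'rV[R]_n) x u
    (lam : 'rV[R]_n) (y : 'rV[R]_d) (v : 'rV[R]_p) : R :=
  tensor (hess_xx f x u) y y lam + 2 * tensor (hess_xu f x u) y v lam
  + tensor (hess_uu f x u) v v lam.

End Derivatives.

Section Control.
Variables (R : realType) (tau n_x n_u : nat).

(* (z_0; ...; z_(tau-1)) |-> z_t *)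
Definition block n (z : 'rV[R]_(tau * n)) (t : 'I_tau) : 'rV[R]_n :=
  row t (vec_mx z).

(* x_t, where x_0 = x0 and x_(t+1) = f_t(x_t, u_t) for t < tau
   (and x_t = 0 for t > tau) *)
Fixpoint traj (f : 'I_tau -> 'rV[R]_n_x -> 'rV[R]_n_u -> 'rV[R]_n_x)
    (x0 : 'rV[R]_n_x) (u : 'rV[R]_(tau * n_u)) (t : nat) : 'rV[R]_n_x :=
  if t is s.+1 then
    if insub s is Some i then f i (traj f x0 u s) (block u i) else 0
  else x0.

Lemma trajS f x0 u (t : 'I_tau) :
  traj f x0 u t.+1 = f t (traj f x0 u t) (block u t).
Proof. by rewrite /= valK. Qed.

Definition control (f : 'I_tau -> 'rV[R]_n_x -> 'rV[R]_n_u -> 'rV[R]_n_x)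
    (x0 : 'rV[R]_n_x) (u : 'rV[R]_(tau * n_u)) : 'rV[R]_(tau * n_x) :=
  mxvec (\matrix_(t < tau) traj f x0 u t.+1).

(* x_t from xs = (x_1; ...; x_tau) and x_0 = x0: the blocks of xs are shifted
   by one *)
Definition state (x0 : 'rV[R]_n_x) (xs : 'rV[R]_(tau * n_x)) (t : nat) :
    'rV[R]_n_x :=
  if t is s.+1 then if insub s is Some i then block xs i else 0 else x0.

Lemma state_control f x0 u t : (t <= tau)%N ->
  state x0 (control f x0 u) t = traj f x0 u t.
Proof.
case: t => [//|t] lt_t /=; rewrite insubT /=.
by rewrite /block /control mxvecK rowK /= insubT.
Qed.

Definition total_cost (h : 'I_tau -> 'rV[R]_n_x -> 'rV[R]_n_u -> R)
    (hT : 'rV[R]_n_x -> R) (x0 : 'rV[R]_n_x)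
    (xs : 'rV[R]_(tau * n_x)) (us : 'rV[R]_(tau * n_u)) : R :=
  \sum_(t < tau) h t (state x0 xs t) (block us t) + hT (state x0 xs tau).

Definition traj_ctrl (f : 'I_tau -> 'rV[R]_n_x -> 'rV[R]_n_u -> 'rV[R]_n_x)
    (x0 : 'rV[R]_n_x) (us : 'rV[R]_(tau * n_u)) :
    'rV[R]_(tau * n_x + tau * n_u) :=
  row_mx (control f x0 us) us.

(* Only y_0, ..., y_tau matter in y. *)
Definition lq_feasible (l : 'I_tau -> 'rV[R]_n_x -> 'rV[R]_n_u -> 'rV[R]_n_x)
    (y : nat -> 'rV[R]_n_x) (v : 'rV[R]_(tau * n_u)) : Prop :=
  y 0%N = 0 /\ forall t : 'I_tau, y t.+1 = l t (y t) (block v t).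

Definition lq_cost (q : 'I_tau -> 'rV[R]_n_x -> 'rV[R]_n_u -> R)
    (qT : 'rV[R]_n_x -> R)
    (y : nat -> 'rV[R]_n_x) (v : 'rV[R]_(tau * n_u)) : R :=
  \sum_(t < tau) q t (y t) (block v t) + qT (y tau).

Definition lq_solution l q qT y v : Prop :=
  lq_feasible l y v /\
  forall y' v', lq_feasible l y' v' -> lq_cost q qT y v <= lq_cost q qT y' v'.

End Control.

Section Oracles.
Variables (R : realType) (d n : nat).

Definition is_argmin (F : 'rV[R]_d -> R) (v : 'rV[R]_d) : Prop :=
  forall w, F v <= F w.

Definition gradient_objective (h : 'rV[R]_n -> R) (g : 'rV[R]_d -> 'rV[R]_n)
    (u : 'rV[R]_d) (nu : R) (v : 'rV[R]_d) : R :=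
  lin (h \o g) u v + nu / 2 * sqnorm v.

Definition gauss_newton_objective (h : 'rV[R]_n -> R)
    (g : 'rV[R]_d -> 'rV[R]_n) (u : 'rV[R]_d) (nu : R) (v : 'rV[R]_d) : R :=
  quad h (g u) (vlin g u v) + nu / 2 * sqnorm v.

Definition newton_objective (h : 'rV[R]_n -> R) (g : 'rV[R]_d -> 'rV[R]_n)
    (u : 'rV[R]_d) (nu : R) (v : 'rV[R]_d) : R :=
  quad (h \o g) u v + nu / 2 * sqnorm v.

End Oracles.

(* Main.v *)
Require Import Defs.
From mathcomp Require Import all_boot all_order all_algebra.
From mathcomp Require Import all_classical all_reals all_analysis.
From mathcomp Require Import ring.

Import Order.TTheory GRing.Theory Num.Theory.
Import numFieldNormedType.Exports.

Local Open Scope ring_scope.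

(** The states of the linear quadratic problem are determined by its controls:
    the dynamics started at 0 produce exactly one trajectory for each v, and
    this trajectory is the derivative y_t of the control-to-state map in the
    direction v ([vlin_traj]). Substituting it, the problem becomes the
    unconstrained minimization of a function of v ([argmin_lq_solution]), so it
    suffices to show that this function is the objective of the oracle.

    For the gradient oracle this is the chain rule, and for the Gauss-Newton
    oracle it is the expansion of the separable cost h at g(u), evaluated at the
    derivative of g. The squared norm splits over the blocks of v in all three
    cases.

    For the Newton oracle, the second-order chain rule ([bilin_hess_comp]) adds
    to the Gauss-Newton terms the gradients of the costs applied to the second
    derivatives s_t of the states along v. These obey an affine recursion with
    the dynamics of the linearization, driven by the curvatures of the f_t
    along (y_t, v_t). The costates lam solve the adjoint recursion, so a
    summation by parts ([adjoint_sum]) replaces the terms in s_t by the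
    curvatures paired with lam_(t+1).

    These curvatures are those of f_t as a function of the joint variable, while
    the form in the statement uses one mixed block of the Hessian with the
    factor 2. The two agree by the symmetry of second derivatives, which
    holds at each point where the first derivatives are differentiable
    ([derive_derive_sym]). *)

Set Implicit Arguments.
Unset Strict Implicit.

(** * Differentiability of matrix-valued maps, entry by entry *)

Section Entrywise.
Context {R : realType}.

Lemma differentiable_mxP (V : normedModType R) m n (f : V -> 'M[R]_(m, n)) x :
  differentiable f x <-> forall i j, differentiable (fun z => f z i j) x.
Proof.
split=> [df i j|df].
  apply: (@differentiable_comp _ _ _ _ f (fun N : 'M[R]_(m, n) => N i j)) => //.
  exact: differentiable_coord.
have -> : f = \sum_(i < m) \sum_(j < n) (fun z => f z i j *: delta_mx i j).
  apply/funext=> z; rewrite fct_sumE [LHS]matrix_sum_delta.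
  by apply: eq_bigr => i _; rewrite fct_sumE.
apply: differentiable_sum => i; apply: differentiable_sum => j.
exact: differentiableZl.
Qed.

Lemma twice_differentiable_scalarP d (phi : 'rV[R]_d -> R) :
  twice_differentiable_scalar phi <->
  forall x, differentiable phi x /\ forall j, differentiable (pd j phi) x.
Proof.
split=> dphi x; have [d1 d2] := dphi x; split=> //.
  move=> j; have /differentiable_mxP/(_ 0 j) := d2.
  by congr (differentiable _ _); apply/funext => z; rewrite mxE.
apply/differentiable_mxP => i j; have := d2 j.
by congr (differentiable _ _); apply/funext => z; rewrite mxE.
Qed.

Lemma twice_differentiable_coordP d n (f : 'rV[R]_d -> 'rV[R]_n) :
  twice_differentiable f <->
  forall k, twice_differentiable_scalar (fun z => f z 0 k).
Proof.
split=> [df k|df x].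
  apply/twice_differentiable_scalarP => x; have [d1 d2] := df x; split.
    by move/differentiable_mxP: d1; apply.
  move=> j; move/differentiable_mxP/(_ j k): d2.
  by congr (differentiable _ _); apply/funext => z; rewrite mxE.
split; apply/differentiable_mxP => i j.
  by rewrite ord1; have /twice_differentiable_scalarP/(_ x)[] := df j.
have /twice_differentiable_scalarP/(_ x)[_ /(_ i)] := df j.
by congr (differentiable _ _); apply/funext => z; rewrite mxE.
Qed.

End Entrywise.

(** * First-order chain rule *)

Section FirstOrder.
Context {R : realType}.

(** Differentiability is what makes the partial derivatives determine all
    directional ones, so that the chain rule for differentials can be read on
    the expansions lin and vlin. *)
Lemma derive_lin d (phi : 'rV[R]_d -> R) x v :
  differentiable phi x -> 'D_v phi x = lin phi x v.
Proof.
move=> dphi; rewrite deriveE // [in LHS](row_sum_delta v) linear_sum.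
by apply: eq_bigr => i _; rewrite linearZ /= -deriveE //= mulrC.
Qed.

Lemma derive_coord d n (f : 'rV[R]_d -> 'rV[R]_n) x v k :
  differentiable f x -> ('D_v f x) 0 k = vlin f x v 0 k.
Proof.
move=> df; have dk : differentiable (fun z => f z 0 k) x.
  by move/differentiable_mxP: df; apply.
rewrite derive_mx; last exact: diff_derivable.
rewrite mxE derive_lin // /vlin mxE.
by apply: eq_bigr => i _; rewrite mxE mulrC.
Qed.

Lemma vlinE d n (f : 'rV[R]_d -> 'rV[R]_n) x v :
  differentiable f x -> vlin f x v = 'D_v f x.
Proof. by move=> df; apply/rowP => k; rewrite derive_coord. Qed.

Lemma lin_comp d n (phi : 'rV[R]_n -> R) (f : 'rV[R]_d -> 'rV[R]_n) x v :
  differentiable f x -> differentiable phi (f x) ->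
  lin (phi \o f) x v = lin phi (f x) (vlin f x v).
Proof.
move=> df dphi; have dc := differentiable_comp df dphi.
by rewrite -!derive_lin // vlinE // !deriveE // diff_comp.
Qed.

Lemma vlin_comp d n p (g : 'rV[R]_n -> 'rV[R]_p) (f : 'rV[R]_d -> 'rV[R]_n) x v :
  differentiable f x -> differentiable g (f x) ->
  vlin (g \o f) x v = vlin g (f x) (vlin f x v).
Proof.
move=> df dg; have dc := differentiable_comp df dg.
by rewrite !vlinE // !deriveE // diff_comp.
Qed.

Lemma pd_lin d (phi : 'rV[R]_d -> R) x i :
  lin phi x (delta_mx 0 i) = pd i phi x.
Proof.
rewrite /lin (bigD1 i) //= mxE !eqxx mulr1 big1 ?addr0 // => j ji.
by rewrite mxE (negbTE ji) mulr0.
Qed.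

Lemma pd_comp d n (phi : 'rV[R]_n -> R) (f : 'rV[R]_d -> 'rV[R]_n) x i :
  differentiable f x -> differentiable phi (f x) ->
  pd i (phi \o f) x = \sum_k pd k phi (f x) * pd i (fun z => f z 0 k) x.
Proof.
move=> df dphi; rewrite -pd_lin lin_comp //.
by apply: eq_bigr => k _; rewrite /vlin -rowE !mxE.
Qed.

End FirstOrder.

(** * Second-order chain rule *)

Section SecondOrder.
Context {R : realType}.

(** nabla^2 f(x)[v, v, .] *)
Definition vhess d n (f : 'rV[R]_d -> 'rV[R]_n) x v : 'rV[R]_n :=
  \row_k bilin (hess (fun z => f z 0 k) x) v v.

Lemma pd_compE d n (phi : 'rV[R]_n -> R) (f : 'rV[R]_d -> 'rV[R]_n) i :
  twice_differentiable_scalar phi -> twice_differentiable f ->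
  pd i (phi \o f) =
  \sum_k ((pd k phi \o f) * pd i (fun z => f z 0 k)).
Proof.
move=> dphi df; apply/funext => x; rewrite fct_sumE.
by apply: pd_comp; [have [] := df x|have [] := dphi (f x)].
Qed.

(** By the chain rule each partial derivative of the composite is a sum of
    products of differentiable functions. *)
Lemma twice_differentiable_scalar_comp d n (phi : 'rV[R]_n -> R)
    (f : 'rV[R]_d -> 'rV[R]_n) :
  twice_differentiable_scalar phi -> twice_differentiable f ->
  twice_differentiable_scalar (phi \o f).
Proof.
move=> dphi df; apply/twice_differentiable_scalarP => x.
have [df1 _] := df x; have [dphi1 _] := dphi (f x).
split=> [|j]; first exact: differentiable_comp.
rewrite pd_compE //; apply: differentiable_sum => k.
apply: differentiableM.
  apply: differentiable_comp => //.
  by have /twice_differentiable_scalarP/(_ (f x))[] := dphi.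
by have /twice_differentiable_coordP/(_ k)/twice_differentiable_scalarP/(_ x)[] := df.
Qed.

Lemma twice_differentiable_comp d n p (g : 'rV[R]_n -> 'rV[R]_p)
    (f : 'rV[R]_d -> 'rV[R]_n) :
  twice_differentiable g -> twice_differentiable f ->
  twice_differentiable (g \o f).
Proof.
move=> dg df; apply/twice_differentiable_coordP => k.
apply: (twice_differentiable_scalar_comp (phi := fun z => g z 0 k)) => //.
by move/twice_differentiable_coordP: dg; apply.
Qed.

(** Differentiate pd j (phi o f) = sum_k (pd k phi o f) * pd j f_k once more:
    the first factors give the quadratic term in grad f, the second factors
    the curvature of f weighted by the gradient of phi. *)
Lemma hess_comp d n (phi : 'rV[R]_n -> R) (f : 'rV[R]_d -> 'rV[R]_n) x :
  twice_differentiable_scalar phi -> twice_differentiable f ->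
  hess (phi \o f) x = grad f x *m hess phi (f x) *m (grad f x)^T
    + \sum_k pd k phi (f x) *: hess (fun z => f z 0 k) x.
Proof.
move=> dphi df; apply/matrixP => i j.
have [df1 _] := df x.
have d1 k : differentiable (pd k phi) (f x).
  by have /twice_differentiable_scalarP/(_ (f x))[] := dphi.
have d2 k : differentiable (pd j (fun z => f z 0 k)) x.
  by have /twice_differentiable_coordP/(_ k)/twice_differentiable_scalarP/(_ x)[] := df.
have d3 k : differentiable (pd k phi \o f) x by exact: differentiable_comp.
rewrite mxE pd_compE // /pd derive_sum; last first.
  by move=> k; apply/diff_derivable; apply: differentiableM; [exact: d3|exact: d2].
rewrite !mxE summxE -big_split; apply: eq_bigr => k _.
rewrite deriveM; [|exact: (diff_derivable (d3 k))|exact: (diff_derivable (d2 k))].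
rewrite -[LHS]/(pd k phi (f x) * pd i (pd j (fun z => f z 0 k)) x
  + pd j (fun z => f z 0 k) x * pd i (pd k phi \o f) x) (pd_comp _ df1 (d1 k)) addrC.
rewrite [RHS]/= !mxE; congr (_ + _); rewrite mulrC; congr (_ * _).
by apply: eq_bigr => l _; rewrite !mxE mulrC.
Qed.

Lemma bilin_sum d p n (c : 'I_n -> R) (A : 'I_n -> 'M[R]_(d, p)) a b :
  bilin (\sum_k c k *: A k) a b = \sum_k c k * bilin (A k) a b.
Proof.
rewrite /bilin mulmx_sumr mulmx_suml summxE; apply: eq_bigr => k _.
by rewrite -scalemxAr -scalemxAl mxE.
Qed.

(** The curvature of f enters through a term linear in phi. This is where the
    Newton and the Gauss-Newton models differ, and the term that the costates
    propagate. *)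
Lemma bilin_hess_comp d n (phi : 'rV[R]_n -> R) (f : 'rV[R]_d -> 'rV[R]_n) x v :
  twice_differentiable_scalar phi -> twice_differentiable f ->
  bilin (hess (phi \o f) x) v v =
  bilin (hess phi (f x)) (vlin f x v) (vlin f x v)
  + lin phi (f x) (vhess f x v).
Proof.
move=> dphi df; rewrite hess_comp // {1}/bilin mulmxDr mulmxDl mxE.
congr (_ + _); first by rewrite /bilin /vlin trmx_mul !mulmxA.
rewrite -[LHS]/(bilin _ v v) bilin_sum.
by apply: eq_bigr => k _; rewrite mxE.
Qed.

End SecondOrder.

(** * Symmetry of second derivatives *)

Section Schwarz.
Context {R : realType}.

(** Directional derivatives depend on the values along a line only. Hence
    partial derivatives in one group of variables can be computed with the
    others frozen, and derivatives along a line with one real variable. *)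
Lemma derive_reparam (V V' W : normedModType R) (F : V -> W) (G : V' -> W)
    x v y w :
  (forall s : R, F (s *: v + x) = G (s *: w + y)) ->
  'D_v F x = 'D_w G y /\ (derivable G y w -> derivable F x v).
Proof.
move=> FG; have FG0 : F x = G y by move: (FG 0); rewrite !scale0r !add0r.
have E : (fun h : R => h^-1 *: ((F \o shift x) (h *: v) - F x)) =
         (fun h : R => h^-1 *: ((G \o shift y) (h *: w) - G y)).
  by apply/funext => h /=; rewrite FG FG0.
by rewrite /derive /derivable E.
Qed.

(** By the mean value theorem along a, the second difference is s times the
    increment of 'D_a phi between two points that differ by s b, both at
    distance O(s) of x. Differentiability of 'D_a phi at the single point x
    evaluates this increment up to o(s). *)
Lemma second_difference (V : normedModType R) (phi : V -> R) (x a b : V) :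
  (forall z, differentiable phi z) -> differentiable ('D_a phi) x ->
  forall e : R, 0 < e -> exists2 dl : R, 0 < dl & forall s, 0 < s < dl ->
    `|phi (s *: a + s *: b + x) - phi (s *: a + x) - phi (s *: b + x) + phi x
      - s ^+ 2 * 'D_b ('D_a phi) x| <= e * s ^+ 2.
Proof.
move=> dphi dg e e0; set g := 'D_a phi.
(* The final 1 makes M positive even if a = b = 0. *)
pose M := `|a| + `|b| + 1.
have M0 : 0 < M by rewrite ltr_wpDl // addr_ge0.
have eM : 0 < e / (2 * M) by rewrite divr_gt0 // mulr_gt0.
have /eqaddoP/(_ _ eM)/nbhs_norm0P[/= d d0 Hd] := diff_locally dg.
exists (d / M) => [|s /andP[s0 sd]]; first by rewrite divr_gt0.
have sM : s * M < d by rewrite -ltr_pdivlMr.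
have smallM (z : V) : `|z| <= s * M ->
    `|g (z + x) - g x - 'd g x z| <= e / (2 * M) * (s * M).
  move=> zM; have /= := Hd z (le_lt_trans zM sM).
  by rewrite -/g opprD addrA => /le_trans; apply; rewrite ler_wpM2l // ltW.
pose psi (r : R) := phi (r *: a + (s *: b + x)) - phi (r *: a + x).
pose dpsi (r : R) := g (r *: a + (s *: b + x)) - g (r *: a + x).
have dline (y : V) (r : R) :
    is_derive r 1 (fun r => phi (r *: a + y)) (g (r *: a + y)).
  have [|E D] := @derive_reparam R^o V R (fun r : R => phi (r *: a + y)) phi r 1
      (r *: a + y) a.
    by move=> h; rewrite [h *: 1]mulr1 scalerDl addrA.
  by apply: DeriveDef; [apply: D; exact: diff_derivable | exact: E].
have dpsiE (r : R) : is_derive (r : R^o) 1 psi (dpsi r) by exact: is_deriveB.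
have cpsi : {within `[0, s], continuous psi}%classic.
  by apply: derivable_within_continuous => r _; have [] := dpsiE r.
have [c /[!in_itv]/= /andP[c0 cs] psiE] := MVT s0 (fun r _ => dpsiE r) cpsi.
have -> : phi (s *: a + s *: b + x) - phi (s *: a + x) - phi (s *: b + x) + phi x
    = dpsi c * s.
  rewrite -[X in _ = _ * X]subr0 -psiE /psi !scale0r !add0r addrA.
  by rewrite opprB addrA addrAC.
have normZ (r : R) (z : V) : 0 <= r -> r <= s -> `|r *: z| <= s * `|z|.
  by move=> r0 rs; rewrite normrZ ger0_norm // ler_wpM2r.
have n1 : `|c *: a + s *: b| <= s * M.
  rewrite (le_trans (ler_normD _ _)) // /M !mulrDr -[leLHS]addr0 lerD //.
    by rewrite lerD // normZ // ltW.
  by rewrite mulr_ge0 // ltW.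
have n2 : `|c *: a| <= s * M.
  rewrite (le_trans (normZ _ _ (ltW c0) (ltW cs))) // ler_wpM2l //; first exact: ltW.
  by rewrite /M -addrA lerDl addr_ge0.
have H1 : `|g (c *: a + (s *: b + x)) - g x - (c * 'd g x a + s * 'D_b g x)|
    <= e / (2 * M) * (s * M).
  have := smallM _ n1; rewrite -[c *: a + s *: b + x]addrA.
  by rewrite linearD !linearZ -(deriveE b dg).
have H2 : `|g (c *: a + x) - g x - c * 'd g x a| <= e / (2 * M) * (s * M).
  by have := smallM _ n2; rewrite linearZ.
rewrite /dpsi; move: H1 H2.
move: (g (c *: a + (s *: b + x))) (g (c *: a + x)) (g x) ('d g x a) ('D_b g x).
move=> A B G L1 L H1 H2.
have -> : (A - B) * s - s ^+ 2 * L =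
    s * ((A - G - (c * L1 + s * L)) - (B - G - c * L1)) by ring.
rewrite normrM (gtr0_norm s0) expr2 mulrCA ler_pM2l //.
rewrite (le_trans (ler_normB _ _)) // (le_trans (lerD H1 H2)) //.
rewrite le_eqVlt; apply/orP; left; apply/eqP; field.
by rewrite (gt_eqF M0).
Qed.

(** The second difference is symmetric in a and b, so both mixed derivatives
    are its limit after division by s^2. *)
Lemma derive_derive_sym (V : normedModType R) (phi : V -> R) (x a b : V) :
  (forall z, differentiable phi z) ->
  differentiable ('D_a phi) x -> differentiable ('D_b phi) x ->
  'D_a ('D_b phi) x = 'D_b ('D_a phi) x.
Proof.
move=> dphi da db; apply/eqP; rewrite -subr_eq0 -normr_le0.
apply/ler_addgt0Pl => e e0; rewrite addr0.
have e2 : 0 < e / 2 by rewrite divr_gt0.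
have [d1 d10 H1] := second_difference b dphi da e2.
have [d2 d20 H2] := second_difference a dphi db e2.
pose s := Num.min d1 d2 / 2.
have s0 : 0 < s by rewrite divr_gt0 // lt_min d10.
have sm : s < Num.min d1 d2 by rewrite ltr_pdivrMr // mulr_natr mulr2n ltrDl lt_min d10.
move: sm; rewrite lt_min => /andP[s1 s2].
have := H2 s; have := H1 s; rewrite s0 s1 s2 => /(_ isT) K1 /(_ isT).
rewrite [s *: b + s *: a]addrC (addrAC (phi _) (- phi (s *: b + x))) => K2.
rewrite -(@ler_pM2l _ (s ^+ 2)) ?exprn_gt0 //.
rewrite -[X in X * `|_|]ger0_norm ?exprn_ge0 ?(ltW s0) // -normrM.
move: K1 K2; move: (_ - _ - _ + _) ('D_a _ x) ('D_b _ x) => D Lab Lba K1 K2.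
have -> : s ^+ 2 * (Lab - Lba) = (D - s ^+ 2 * Lba) - (D - s ^+ 2 * Lab) by ring.
rewrite (le_trans (ler_normB _ _)) // (le_trans (lerD K1 K2)) //.
by rewrite -mulrDl -splitr mulrC.
Qed.

Lemma hess_sym d (phi : 'rV[R]_d -> R) x :
  twice_differentiable_scalar phi -> (hess phi x)^T = hess phi x.
Proof.
move=> /twice_differentiable_scalarP dphi; apply/matrixP => i j; rewrite !mxE.
have [_ dx] := dphi x; apply: derive_derive_sym; [|exact: dx..].
by move=> z; have [] := dphi z.
Qed.

End Schwarz.

(** * Block form of the Hessian in two variables *)

Section JointHessian.
Context {R : realType} {d p : nat}.

Lemma pd_joint_l (F : 'rV[R]_(d + p) -> R) x u i :
  pd (lshift p i) F (row_mx x u) = pd i (fun x' => F (row_mx x' u)) x.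
Proof.
rewrite /pd; have [|-> _ //] := @derive_reparam R _ _ R F
  (fun x' => F (row_mx x' u)) (row_mx x u) (delta_mx 0 (lshift p i)) x
  (delta_mx 0 i).
move=> s; congr F.
by rewrite delta_mx_lshift scale_row_mx add_row_mx scaler0 add0r.
Qed.

Lemma pd_joint_r (F : 'rV[R]_(d + p) -> R) x u j :
  pd (rshift d j) F (row_mx x u) = pd j (fun u' => F (row_mx x u')) u.
Proof.
rewrite /pd; have [|-> _ //] := @derive_reparam R _ _ R F
  (fun u' => F (row_mx x u')) (row_mx x u) (delta_mx 0 (rshift d j)) u
  (delta_mx 0 j).
move=> s; congr F.
by rewrite delta_mx_rshift scale_row_mx add_row_mx scaler0 add0r.
Qed.

Lemma hess_joint (F : 'rV[R]_d -> 'rV[R]_p -> R) x u :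
  twice_differentiable_scalar (joint F) ->
  let C := \matrix_(i, j) pd i (fun x' => pd j (F x') u) x in
  hess (joint F) (row_mx x u) =
  block_mx (hess (F ^~ u) x) C C^T (hess (F x) u).
Proof.
move=> dF C.
have Fl u' : (fun x' => joint F (row_mx x' u')) = F ^~ u'.
  by apply/funext => x'; rewrite /joint row_mxKl row_mxKr.
have Fr x' : (fun u' => joint F (row_mx x' u')) = F x'.
  by apply/funext => u'; rewrite /joint row_mxKl row_mxKr.
have ulE : ulsubmx (hess (joint F) (row_mx x u)) = hess (F ^~ u) x.
  apply/matrixP => i j; rewrite !mxE pd_joint_l; congr (pd i _ x).
  by apply/funext => x'; rewrite pd_joint_l Fl.
have urE : ursubmx (hess (joint F) (row_mx x u)) = C.
  apply/matrixP => i j; rewrite !mxE pd_joint_l; congr (pd i _ x).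
  by apply/funext => x'; rewrite pd_joint_r Fr.
have drE : drsubmx (hess (joint F) (row_mx x u)) = hess (F x) u.
  apply/matrixP => i j; rewrite !mxE pd_joint_r; congr (pd i _ u).
  by apply/funext => u'; rewrite pd_joint_r Fr.
rewrite -[LHS]submxK ulE urE drE; congr (block_mx _ _ _ _).
by rewrite -urE trmx_ursub hess_sym.
Qed.

Lemma bilin_block (A : 'M[R]_d) (C : 'M[R]_(d, p)) (B : 'M[R]_p) y v :
  bilin (block_mx A C C^T B) (row_mx y v) (row_mx y v) =
  bilin A y y + 2 * bilin C y v + bilin B v v.
Proof.
have addE (M N : 'M[R]_1) : (M + N) 0 0 = M 0 0 + N 0 0 by rewrite mxE.
rewrite /bilin mul_row_block tr_row_mx mul_row_col !mulmxDl !addE.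
have -> : (v *m C^T *m y^T) 0 0 = (y *m C *m v^T) 0 0.
  by rewrite -mulmxA -trmx_mul -[v in LHS]trmxK -trmx_mul mxE.
ring.
Qed.

(** The form of the Newton oracle counts the mixed block twice whereas the
    joint Hessian has two mixed blocks; they agree because the latter is
    symmetric. *)
Lemma hess_formE n (f : 'rV[R]_d -> 'rV[R]_p -> 'rV[R]_n) x u lam y v :
  twice_differentiable (joint f) ->
  hess_form f x u lam y v =
  \sum_k lam 0 k * vhess (joint f) (row_mx x u) (row_mx y v) 0 k.
Proof.
move=> /twice_differentiable_coordP df.
rewrite /hess_form /tensor mulr_sumr -!big_split; apply: eq_bigr => k _ /=.
rewrite mxE (hess_joint (F := fun x' u' => f x' u' 0 k)) ?bilin_block; last exact: df.
rewrite /hess_xx /hess_xu /hess_uu; ring.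
Qed.

End JointHessian.

(** * Expansions of constant, linear, paired and summed maps *)

Section Calculus.
Context {R : realType}.

Lemma vlin_coord d n (f : 'rV[R]_d -> 'rV[R]_n) x v k :
  vlin f x v 0 k = lin (fun z => f z 0 k) x v.
Proof. by rewrite mxE; apply: eq_bigr => i _; rewrite mxE mulrC. Qed.

(** Applied to x_(t+1) = f_t(x_t, u_t), this is the recursion of the second
    derivative of the trajectory. *)
Lemma vhess_comp d n p (g : 'rV[R]_n -> 'rV[R]_p) (f : 'rV[R]_d -> 'rV[R]_n)
    x v :
  twice_differentiable g -> twice_differentiable f ->
  vhess (g \o f) x v =
  vhess g (f x) (vlin f x v) + vlin g (f x) (vhess f x v).
Proof.
move=> /twice_differentiable_coordP dg df; apply/rowP => k.
by rewrite [RHS]mxE vlin_coord !mxE -(bilin_hess_comp _ _ (dg k) df).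
Qed.

Lemma pd_cst d (c : R) i : pd i (fun _ : 'rV[R]_d => c) = cst 0.
Proof. by apply/funext => z; exact: derive_cst. Qed.

Lemma twice_differentiable_scalar_cst d (c : R) :
  twice_differentiable_scalar (fun _ : 'rV[R]_d => c).
Proof.
apply/twice_differentiable_scalarP => x; split; first exact: differentiable_cst.
by move=> j; rewrite pd_cst; exact: differentiable_cst.
Qed.

Lemma twice_differentiable_cst d n (c : 'rV[R]_n) :
  twice_differentiable (fun _ : 'rV[R]_d => c).
Proof.
apply/twice_differentiable_coordP => k; exact: twice_differentiable_scalar_cst.
Qed.

Lemma vlin_cst d n (c : 'rV[R]_n) (x v : 'rV[R]_d) : vlin (fun=> c) x v = 0.
Proof.
apply/rowP => k; rewrite vlin_coord mxE; apply: big1 => i _.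
by rewrite pd_cst mul0r.
Qed.

Lemma hess_cst d (c : R) (x : 'rV[R]_d) : hess (fun=> c) x = 0.
Proof. by apply/matrixP => i j; rewrite !mxE !pd_cst. Qed.

Lemma vhess_cst d n (c : 'rV[R]_n) (x v : 'rV[R]_d) : vhess (fun=> c) x v = 0.
Proof.
by apply/rowP => k; rewrite !mxE hess_cst /bilin mulmx0 mul0mx mxE.
Qed.

Section Linear.
Variables (d n : nat) (L : {linear 'rV[R]_d -> 'rV[R]_n}).

Lemma pd_linear k j : pd j (fun z => L z 0 k) = cst (L (delta_mx 0 j) 0 k).
Proof.
apply/funext => z; rewrite /pd.
have [|-> _] := @derive_reparam R _ R^o R (fun z => L z 0 k)
  (fun r : R => r * L (delta_mx 0 j) 0 k + L z 0 k) z (delta_mx 0 j) 0 1.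
  by move=> s; rewrite linearP !mxE addr0 [s *: 1]mulr1.
rewrite deriveD; [|exact: diff_derivable..].
by rewrite derive_cst addr0 deriveMr // derive_id mulr1.
Qed.

Lemma twice_differentiable_linear : twice_differentiable L.
Proof.
apply/twice_differentiable_coordP => k; apply/twice_differentiable_scalarP => x.
split=> [|j]; last by rewrite pd_linear; exact: differentiable_cst.
have -> : (fun z => L z 0 k) =
    \sum_(i < d) (fun z : 'rV_d => z 0 i *: L (delta_mx 0 i) 0 k).
  apply/funext => z; rewrite fct_sumE [in LHS](row_sum_delta z) linear_sum.
  by rewrite summxE; apply: eq_bigr => i _; rewrite linearZ mxE.
apply: differentiable_sum => i; apply: differentiableZl.
exact: differentiable_coord.
Qed.

Lemma vlin_linear x v : vlin L x v = L v.
Proof.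
apply/rowP => k; rewrite vlin_coord [in RHS](row_sum_delta v) linear_sum summxE.
by apply: eq_bigr => i _; rewrite pd_linear linearZ mxE mulrC.
Qed.

Lemma vhess_linear x v : vhess L x v = 0.
Proof.
apply/rowP => k; rewrite !mxE /bilin.
suff -> : hess (fun z => L z 0 k) x = 0 by rewrite mulmx0 mul0mx mxE.
by apply/matrixP => i j; rewrite !mxE pd_linear pd_cst.
Qed.

End Linear.

Section Pairing.
Variables (d m n : nat) (f : 'rV[R]_d -> 'rV[R]_m) (g : 'rV[R]_d -> 'rV[R]_n).
Let fg z := row_mx (f z) (g z).

Let fg_l k : (fun z => fg z 0 (lshift n k)) = (fun z => f z 0 k).
Proof. by apply/funext => z; rewrite /fg row_mxEl. Qed.

Let fg_r k : (fun z => fg z 0 (rshift m k)) = (fun z => g z 0 k).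
Proof. by apply/funext => z; rewrite /fg row_mxEr. Qed.

Lemma twice_differentiable_row_mx :
  twice_differentiable f -> twice_differentiable g -> twice_differentiable fg.
Proof.
move=> /twice_differentiable_coordP df /twice_differentiable_coordP dg.
apply/twice_differentiable_coordP => k.
by case: (split_ordP k) => i ->; rewrite ?fg_l ?fg_r.
Qed.

Lemma vlin_row_mx x v : vlin fg x v = row_mx (vlin f x v) (vlin g x v).
Proof.
apply/rowP => k; rewrite vlin_coord.
by case: (split_ordP k) => i ->; rewrite ?fg_l ?fg_r ?row_mxEl ?row_mxEr vlin_coord.
Qed.

Lemma vhess_row_mx x v : vhess fg x v = row_mx (vhess f x v) (vhess g x v).
Proof.
apply/rowP => k; rewrite mxE.
by case: (split_ordP k) => i ->; rewrite ?fg_l ?fg_r ?row_mxEl ?row_mxEr mxE.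
Qed.

End Pairing.

(** Twice differentiability travels with the values of the two terms of the
    expansion, because additivity of the latter needs the former. *)
Definition has_expansion d (phi : 'rV[R]_d -> R) x v (a b : R) : Prop :=
  [/\ twice_differentiable_scalar phi, lin phi x v = a
    & bilin (hess phi x) v v = b].

Lemma has_expansion_comp d n (phi : 'rV[R]_n -> R) (f : 'rV[R]_d -> 'rV[R]_n)
    x v :
  twice_differentiable_scalar phi -> twice_differentiable f ->
  has_expansion (fun z => phi (f z)) x v
    (lin phi (f x) (vlin f x v))
    (bilin (hess phi (f x)) (vlin f x v) (vlin f x v)
     + lin phi (f x) (vhess f x v)).
Proof.
move=> dphi df; split; last exact: bilin_hess_comp.
  exact: twice_differentiable_scalar_comp.
by apply: lin_comp; [have [] := df x|have [] := dphi (f x)].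
Qed.

Lemma has_expansionD d (phi psi : 'rV[R]_d -> R) x v a b a' b' :
  has_expansion phi x v a b -> has_expansion psi x v a' b' ->
  has_expansion (phi + psi) x v (a + a') (b + b').
Proof.
move=> [/twice_differentiable_scalarP dphi <- <-].
move=> [/twice_differentiable_scalarP dpsi <- <-].
have pdD z j : pd j (phi + psi) z = pd j phi z + pd j psi z.
  have [dphi1 _] := dphi z; have [dpsi1 _] := dpsi z.
  by apply: deriveD; apply: diff_derivable.
have pdDE j : pd j (phi + psi) = pd j phi + pd j psi.
  by apply/funext => z; exact: pdD.
split.
- apply/twice_differentiable_scalarP => z.
  have [dphi1 dphi2] := dphi z; have [dpsi1 dpsi2] := dpsi z.
  by split=> [|j]; rewrite ?pdDE; apply: differentiableD.
- by rewrite /lin -big_split; apply: eq_bigr => i _; rewrite pdD mulrDl.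
have -> : hess (phi + psi) x = hess phi x + hess psi x.
  have [_ dphi2] := dphi x; have [_ dpsi2] := dpsi x.
  apply/matrixP => i j; rewrite [LHS]mxE pdDE [RHS]mxE ![hess _ _ _ _]mxE.
  by apply: deriveD; apply: diff_derivable; [exact: dphi2|exact: dpsi2].
by rewrite /bilin mulmxDr mulmxDl mxE.
Qed.

Lemma has_expansion_sum d n (phi : 'I_n -> 'rV[R]_d -> R) x v a b :
  (forall t, has_expansion (phi t) x v (a t) (b t)) ->
  has_expansion (\sum_t phi t) x v (\sum_t a t) (\sum_t b t).
Proof.
move=> H; elim/big_ind3: _ => //; last first.
  by move=> *; exact: has_expansionD.
split; first exact: twice_differentiable_scalar_cst.
  by apply: big1 => i _; rewrite (pd_cst 0) mul0r.
by rewrite (hess_cst 0) /bilin mulmx0 mul0mx mxE.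
Qed.

(** The common shape of the cost as a function of the controls alone and as a
    function of states and controls. *)
Lemma has_expansion_stages d m n k (phi : 'I_k -> 'rV[R]_m -> R)
    (phiT : 'rV[R]_n -> R) (Z : 'I_k -> 'rV[R]_d -> 'rV[R]_m)
    (ZT : 'rV[R]_d -> 'rV[R]_n) x v :
  (forall t, twice_differentiable_scalar (phi t)) ->
  twice_differentiable_scalar phiT ->
  (forall t, twice_differentiable (Z t)) -> twice_differentiable ZT ->
  has_expansion (fun z => \sum_t phi t (Z t z) + phiT (ZT z)) x v
    (\sum_t lin (phi t) (Z t x) (vlin (Z t) x v)
     + lin phiT (ZT x) (vlin ZT x v))
    (\sum_t (bilin (hess (phi t) (Z t x)) (vlin (Z t) x v) (vlin (Z t) x v)
             + lin (phi t) (Z t x) (vhess (Z t) x v))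
     + (bilin (hess phiT (ZT x)) (vlin ZT x v) (vlin ZT x v)
        + lin phiT (ZT x) (vhess ZT x v))).
Proof.
move=> dphi dphiT dZ dZT.
have -> : (fun z => \sum_t phi t (Z t z) + phiT (ZT z)) =
    \sum_t (fun z => phi t (Z t z)) + (fun z => phiT (ZT z)).
  by apply/funext => z; rewrite [in RHS]/GRing.add /= fct_sumE.
apply: has_expansionD; last exact: has_expansion_comp.
by apply: has_expansion_sum => t; exact: has_expansion_comp.
Qed.

Lemma lin0r d (phi : 'rV[R]_d -> R) x : lin phi x 0 = 0.
Proof. by apply: big1 => i _; rewrite mxE mulr0. Qed.

End Calculus.

(** * Derivatives of the trajectory *)

Section Blocks.
Context {R : realType} {tau n : nat}.

Definition block_linear (t : 'I_tau) : {linear 'rV[R]_(tau * n) -> 'rV[R]_n} :=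
  row t \o vec_mx.

Lemma twice_differentiable_block t :
  twice_differentiable (fun z : 'rV[R]_(tau * n) => block z t).
Proof. exact: (twice_differentiable_linear (block_linear t)). Qed.

Lemma vlin_block t (z v : 'rV[R]_(tau * n)) :
  vlin (fun z => block z t) z v = block v t.
Proof. exact: (vlin_linear (block_linear t)). Qed.

Lemma vhess_block t (z v : 'rV[R]_(tau * n)) :
  vhess (fun z => block z t) z v = 0.
Proof. exact: (vhess_linear (block_linear t)). Qed.

Lemma sqnorm_block (v : 'rV[R]_(tau * n)) :
  sqnorm v = \sum_t sqnorm (block v t).
Proof.
rewrite /sqnorm pair_big /= (reindex _ (curry_mxvec_bij _ _)) /=.
by apply: eq_bigr => -[i j] _ /=; rewrite /block !mxE.
Qed.

End Blocks.

Section Trajectories.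
Context {R : realType} {tau n_x n_u : nat}.
Variables (f : 'I_tau -> 'rV[R]_n_x -> 'rV[R]_n_u -> 'rV[R]_n_x).
Variables (x0 : 'rV[R]_n_x) (u v : 'rV[R]_(tau * n_u)).
Hypothesis f_diff : forall t, twice_differentiable (joint (f t)).

Let x := traj f x0 u.
Let l t := vlin2 (f t) (x t) (block u t).

Let stage (t : 'I_tau) u' := row_mx (traj f x0 u' t) (block u' t).

Let traj_stage (t : 'I_tau) :
  (fun u' => traj f x0 u' t.+1) = joint (f t) \o stage t.
Proof.
by apply/funext => u'; rewrite trajS /= /joint row_mxKl row_mxKr.
Qed.

Lemma traj_past g y0 w t : (tau <= t)%N -> @traj R tau n_x n_u g y0 w t.+1 = 0.
Proof. by move=> le_t /=; rewrite insubF // ltnNge le_t. Qed.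

Lemma twice_differentiable_traj t :
  twice_differentiable (fun u' => traj f x0 u' t).
Proof.
elim: t => [|t IHt]; first exact: twice_differentiable_cst.
have [lt_t|le_t] := ltnP t tau; last first.
  rewrite (_ : (fun u' => _) = fun=> 0); first exact: twice_differentiable_cst.
  by apply/funext => u'; rewrite traj_past.
rewrite (traj_stage (Ordinal lt_t)); apply: twice_differentiable_comp => //.
apply: twice_differentiable_row_mx => //; exact: twice_differentiable_block.
Qed.

Lemma twice_differentiable_stage (t : 'I_tau) :
  twice_differentiable (fun u' => row_mx (traj f x0 u' t) (block u' t)).
Proof.
apply: twice_differentiable_row_mx; first exact: twice_differentiable_traj.
exact: twice_differentiable_block.
Qed.

(** Linearizing the recursion of x_t along v gives the dynamics of the linear
    quadratic problem, started at 0 since x_0 does not depend on u. *)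
Lemma vlin_traj t : vlin (fun u' => traj f x0 u' t) u v = traj l 0 v t.
Proof.
elim: t => [|t IHt]; first exact: vlin_cst.
have [lt_t|le_t] := ltnP t tau; last first.
  rewrite traj_past // (_ : (fun u' => _) = fun=> 0) ?vlin_cst //.
  by apply/funext => u'; rewrite traj_past.
rewrite (trajS _ _ _ (Ordinal lt_t)) (traj_stage (Ordinal lt_t)) vlin_comp.
- by rewrite vlin_row_mx IHt vlin_block.
- by have [] := twice_differentiable_stage (Ordinal lt_t) u.
- by have [] := f_diff (Ordinal lt_t) (stage (Ordinal lt_t) u).
Qed.

Lemma vlin_stage (t : 'I_tau) :
  vlin (fun u' => row_mx (traj f x0 u' t) (block u' t)) u v =
  row_mx (traj l 0 v t) (block v t).
Proof. by rewrite vlin_row_mx vlin_traj vlin_block. Qed.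

Lemma vhess_stage (t : 'I_tau) :
  vhess (fun u' => row_mx (traj f x0 u' t) (block u' t)) u v =
  row_mx (vhess (fun u' => traj f x0 u' t) u v) 0.
Proof. by rewrite vhess_row_mx vhess_block. Qed.

Lemma vhess_trajS (t : 'I_tau) :
  vhess (fun u' => traj f x0 u' t.+1) u v =
  vhess (joint (f t)) (row_mx (x t) (block u t))
    (row_mx (traj l 0 v t) (block v t))
  + vlin (joint (f t)) (row_mx (x t) (block u t))
      (row_mx (vhess (fun u' => traj f x0 u' t) u v) 0).
Proof.
rewrite traj_stage vhess_comp //; last exact: twice_differentiable_stage.
by rewrite vlin_stage vhess_stage.
Qed.

Lemma vlin_traj_ctrl :
  vlin (traj_ctrl f x0) u v = traj_ctrl l 0 v.
Proof.
rewrite vlin_row_mx; congr row_mx; last exact: (vlin_linear idfun).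
apply/rowP => k; rewrite vlin_coord; case/mxvec_indexP: k => t i.
rewrite mxvecE mxE -vlin_traj vlin_coord; congr (lin _ u v).
by apply/funext => u'; rewrite mxvecE mxE.
Qed.

End Trajectories.

(** * The state as a function of the concatenated vectors *)

Section State.
Context {R : realType} {tau n_x n_u : nat}.
Variables (x0 : 'rV[R]_n_x).
Let m := (tau * n_x + tau * n_u)%N.

Lemma state_expansion t (z w : 'rV[R]_m) :
  [/\ twice_differentiable (fun z : 'rV[R]_m => state x0 (lsubmx z) t),
      vlin (fun z : 'rV[R]_m => state x0 (lsubmx z) t) z w
        = state 0 (lsubmx w) t
    & vhess (fun z : 'rV[R]_m => state x0 (lsubmx z) t) z w = 0].
Proof.
case: t => [|t] /=.
  by split; [exact: twice_differentiable_cst|exact: vlin_cst|exact: vhess_cst].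
case: insubP => [i _ _|_]; last first.
  by split; [exact: twice_differentiable_cst|exact: vlin_cst|exact: vhess_cst].
pose L : {linear 'rV[R]_m -> 'rV[R]_n_x} := block_linear i \o lsubmx.
split; [exact: (twice_differentiable_linear L)|exact: (vlin_linear L)|].
exact: (vhess_linear L).
Qed.

Lemma input_expansion t (z w : 'rV[R]_m) :
  [/\ twice_differentiable (fun z : 'rV[R]_m => block (rsubmx z) t),
      vlin (fun z : 'rV[R]_m => block (rsubmx z) t) z w = block (rsubmx w) t
    & vhess (fun z : 'rV[R]_m => block (rsubmx z) t) z w = 0].
Proof.
pose L : {linear 'rV[R]_m -> 'rV[R]_n_u} := block_linear t \o rsubmx.
split; [exact: (twice_differentiable_linear L)|exact: (vlin_linear L)|].
exact: (vhess_linear L).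
Qed.

End State.

(** * Pairing with the costate *)

Section Dot.
Context {R : realType}.

Lemma lin2_l d p (phi : 'rV[R]_d -> 'rV[R]_p -> R) a b w :
  lin2 phi a b w 0 = lin (phi ^~ b) a w.
Proof.
rewrite /lin2 /lin big_split_ord /= [X in _ + X]big1 ?addr0 => [|i _]; last first.
  by rewrite row_mxEr mxE mulr0.
apply: eq_bigr => i _; rewrite row_mxEl pd_joint_l; congr (_ * _); congr (pd i _ a).
by apply/funext => z; rewrite /joint row_mxKl row_mxKr.
Qed.

(** Second derivatives of the trajectory enter in the state only: the controls
    are linear in themselves. *)
Lemma vlin_joint_l d p n (phi : 'rV[R]_d -> 'rV[R]_p -> 'rV[R]_n) a b w :
  vlin (joint phi) (row_mx a b) (row_mx w 0) = vlin (phi ^~ b) a w.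
Proof.
apply/rowP => k; rewrite !vlin_coord.
exact: (lin2_l (fun z c => phi z c 0 k)).
Qed.

Definition dot d (a b : 'rV[R]_d) : R := \sum_k a 0 k * b 0 k.

Lemma lin_dot d (phi : 'rV[R]_d -> R) a w : lin phi a w = dot (sgrad phi a) w.
Proof. by apply: eq_bigr => i _; rewrite mxE. Qed.

Lemma dotDl d (a b c : 'rV[R]_d) : dot (a + b) c = dot a c + dot b c.
Proof. by rewrite /dot -big_split; apply: eq_bigr => k _; rewrite mxE mulrDl. Qed.

Lemma dotDr d (a b c : 'rV[R]_d) : dot a (b + c) = dot a b + dot a c.
Proof. by rewrite /dot -big_split; apply: eq_bigr => k _; rewrite mxE mulrDr. Qed.

Lemma dot_mul_tr d p (a : 'rV[R]_p) (A : 'M[R]_(d, p)) (b : 'rV[R]_d) :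
  dot (a *m A^T) b = dot a (b *m A).
Proof.
have dotE k (c e : 'rV[R]_k) : dot c e = (c *m e^T) 0 0.
  by rewrite mxE; apply: eq_bigr => i _; rewrite mxE.
by rewrite !dotE trmx_mul mulmxA.
Qed.

End Dot.

(** * Eliminating the states of a linear quadratic problem *)

Section LinearQuadratic.
Context {R : realType} {tau n_x n_u : nat}.
Variables (l : 'I_tau -> 'rV[R]_n_x -> 'rV[R]_n_u -> 'rV[R]_n_x).
Variables (q : 'I_tau -> 'rV[R]_n_x -> 'rV[R]_n_u -> R) (qT : 'rV[R]_n_x -> R).

Lemma lq_feasible_traj v : lq_feasible l (traj l 0 v) v.
Proof. by split=> // t; exact: trajS. Qed.

Lemma lq_feasible_unique y v t :
  lq_feasible l y v -> (t <= tau)%N -> y t = traj l 0 v t.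
Proof.
move=> [y0 yS]; elim: t => [//|t IHt] lt_t.
by rewrite (trajS _ _ _ (Ordinal lt_t)) (yS (Ordinal lt_t)) IHt // ltnW.
Qed.

Lemma lq_cost_feasible y v :
  lq_feasible l y v -> lq_cost q qT y v = lq_cost q qT (traj l 0 v) v.
Proof.
move=> yv; rewrite /lq_cost (lq_feasible_unique yv) //; congr (_ + _).
by apply: eq_bigr => t _; rewrite (lq_feasible_unique yv) // ltnW.
Qed.

(** The constraints determine y_0, ..., y_tau from v, so the linear quadratic
    problem is the unconstrained minimization of its reduced cost. *)
Lemma argmin_lq_solution (F : 'rV[R]_(tau * n_u) -> R) v :
  (forall w, F w = lq_cost q qT (traj l 0 w) w) ->
  is_argmin F v <-> exists y, lq_solution l q qT y v.
Proof.
move=> FE; split=> [minv|[y [yv miny] w]].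
  exists (traj l 0 v); split=> [|y' v' y'v']; first exact: lq_feasible_traj.
  by rewrite (lq_cost_feasible y'v') -!FE.
by rewrite !FE -(lq_cost_feasible yv); apply/miny/lq_feasible_traj.
Qed.

Lemma lq_cost_sqnorm nu y v :
  lq_cost (fun t yt vt => q t yt vt + nu / 2 * sqnorm vt) qT y v =
  lq_cost q qT y v + nu / 2 * sqnorm v.
Proof. by rewrite /lq_cost sqnorm_block mulr_sumr big_split addrAC. Qed.

End LinearQuadratic.

(** * The oracle objectives as linear quadratic costs *)

Section Objectives.
Context {R : realType} {tau n_x n_u : nat}.
Variables (f : 'I_tau -> 'rV[R]_n_x -> 'rV[R]_n_u -> 'rV[R]_n_x).
Variables (h : 'I_tau -> 'rV[R]_n_x -> 'rV[R]_n_u -> R) (hT : 'rV[R]_n_x -> R).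
Hypothesis f_diff : forall t, twice_differentiable (joint (f t)).
Hypothesis h_diff : forall t, twice_differentiable_scalar (joint (h t)).
Hypothesis hT_diff : twice_differentiable_scalar hT.
Variables (x0 : 'rV[R]_n_x) (u v : 'rV[R]_(tau * n_u)).

Let H := joint (total_cost h hT x0).
Let g := traj_ctrl f x0.
Let x := traj f x0 u.
Let l t := vlin2 (f t) (x t) (block u t).
Let y := traj l 0 v.
Let s t := vhess (fun u' => traj f x0 u' t) u v.

Lemma cost_trajE :
  H \o g = fun u' => \sum_t joint (h t) (row_mx (traj f x0 u' t) (block u' t))
                     + hT (traj f x0 u' tau).
Proof.
apply/funext => u'; rewrite /= /H /g /joint row_mxKl row_mxKr /total_cost.
rewrite state_control //; congr (_ + _); apply: eq_bigr => t _.
by rewrite state_control ?(ltnW (ltn_ord t)) // row_mxKl row_mxKr.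
Qed.

(** With the curvature of the trajectory, s t, in place: the gradient oracle
    reads the first-order part, the Newton oracle both. *)
Lemma cost_traj_expansion :
  has_expansion (H \o g) u v
    (\sum_t lin2 (h t) (x t) (block u t) (y t) (block v t)
     + lin hT (x tau) (y tau))
    (\sum_t (bilin (hess (joint (h t)) (row_mx (x t) (block u t)))
                   (row_mx (y t) (block v t)) (row_mx (y t) (block v t))
             + lin2 (h t) (x t) (block u t) (s t) 0)
     + (bilin (hess hT (x tau)) (y tau) (y tau) + lin hT (x tau) (s tau))).
Proof.
rewrite cost_trajE.
have := has_expansion_stages u v h_diff hT_diff
  (twice_differentiable_stage x0 f_diff) (twice_differentiable_traj x0 f_diff tau).
rewrite vlin_traj // -/(s tau) -/x -/l -/y.
under eq_bigr => t _ do rewrite vlin_stage //.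
under [in X in has_expansion _ _ _ _ X]eq_bigr => t _
  do rewrite vlin_stage // vhess_stage //.
by [].
Qed.

Lemma gradient_objectiveE nu :
  gradient_objective H g u nu v =
  lq_cost (fun t yt vt => lin2 (h t) (x t) (block u t) yt vt + nu / 2 * sqnorm vt)
    (fun yT => lin hT (x tau) yT) y v.
Proof.
rewrite lq_cost_sqnorm /gradient_objective.
by have [_ -> _] := cost_traj_expansion.
Qed.

(** Here the cost is expanded as a function of states and controls, in which
    the stage variables are affine; hence no curvature term appears. *)
Lemma gauss_newton_objectiveE nu :
  gauss_newton_objective H g u nu v =
  lq_cost (fun t yt vt => quad2 (h t) (x t) (block u t) yt vt + nu / 2 * sqnorm vt)
    (fun yT => quad hT (x tau) yT) y v.
Proof.
rewrite lq_cost_sqnorm /gauss_newton_objective; congr (_ + _).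
rewrite vlin_traj_ctrl // -/x -/l.
set w := traj_ctrl l 0 v.
pose Z (t : 'I_tau) (z : 'rV[R]_(tau * n_x + tau * n_u)) :=
  row_mx (state x0 (lsubmx z) t) (block (rsubmx z) t).
pose ZT (z : 'rV[R]_(tau * n_x + tau * n_u)) := state x0 (lsubmx z) tau.
have dZ t : twice_differentiable (Z t).
  apply: twice_differentiable_row_mx; first by have [] := state_expansion x0 t (g u) w.
  by have [] := input_expansion t (g u) w.
have dZT : twice_differentiable ZT by have [] := state_expansion x0 tau (g u) w.
have ZE t : Z t (g u) = row_mx (x t) (block u t).
  by rewrite /Z row_mxKl row_mxKr state_control // ltnW.
have ZTE : ZT (g u) = x tau by rewrite /ZT row_mxKl state_control.
have vZ t : vlin (Z t) (g u) w = row_mx (y t) (block v t).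
  rewrite vlin_row_mx; have [_ -> _] := state_expansion x0 t (g u) w.
  have [_ -> _] := input_expansion t (g u) w.
  by rewrite row_mxKl row_mxKr state_control // ltnW.
have vZT : vlin ZT (g u) w = y tau.
  have [_ -> _] := state_expansion x0 tau (g u) w.
  by rewrite row_mxKl state_control.
have hZ t : vhess (Z t) (g u) w = 0.
  rewrite vhess_row_mx; have [_ _ ->] := state_expansion x0 t (g u) w.
  by have [_ _ ->] := input_expansion t (g u) w; rewrite row_mx0.
have hZT : vhess ZT (g u) w = 0 by have [] := state_expansion x0 tau (g u) w.
have HE : H = fun z => \sum_t joint (h t) (Z t z) + hT (ZT z).
  apply/funext => z; congr (_ + _); apply: eq_bigr => t _.
  by rewrite /joint row_mxKl row_mxKr.
have [_ l1 l2] := has_expansion_stages (g u) w h_diff hT_diff dZ dZT.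
rewrite /quad HE l1 l2 ZTE vZT hZT lin0r addr0 mulrDr mulr_sumr addrACA -big_split.
congr (_ + _); apply: eq_bigr => t _ /=.
by rewrite ZE vZ hZ lin0r addr0.
Qed.

(** Summation by parts. The vectors s t satisfy
    s (t+1) = c_t + G_t (s t), where c_t is the curvature of f_t along the
    linearized trajectory and G_t its linearization in the state, and lam is
    the backward recursion of the adjoint of G_t. Hence the contribution of
    stage t is lam_(t+1) . c_t plus the telescoping difference of
    lam_t . s t. *)
Lemma adjoint_sum (lam : nat -> 'rV[R]_n_x) :
  lam tau = sgrad hT (x tau) ->
  (forall t : 'I_tau, (1 <= t)%N ->
     lam t = sgrad (fun z => h t z (block u t)) (x t)
             + lam t.+1 *m (grad (fun z => f t z (block u t)) (x t))^T) ->
  \sum_t lin2 (h t) (x t) (block u t) (s t) 0 + lin hT (x tau) (s tau) =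
  \sum_t hess_form (f t) (x t) (block u t) (lam t.+1) (y t) (block v t).
Proof.
move=> lamT lamS.
have s0 : s 0 = 0 by exact: vhess_cst.
have dot0 (a : 'rV[R]_n_x) : dot a 0 = 0 by apply: big1 => k _; rewrite mxE mulr0.
(* The recursion leaves lam 0 free; at t = 0 both sides vanish as s 0 = 0. *)
have costate (t : 'I_tau) : dot (lam t) (s t) =
    lin2 (h t) (x t) (block u t) (s t) 0
    + dot (lam t.+1)
        (vlin (joint (f t)) (row_mx (x t) (block u t)) (row_mx (s t) 0)).
  rewrite lin2_l vlin_joint_l; have [t0|t_gt0] := posnP t.
    by rewrite t0 s0 lin0r /vlin mul0mx !dot0 addr0.
  by rewrite lamS // dotDl dot_mul_tr lin_dot.
have step (t : 'I_tau) : lin2 (h t) (x t) (block u t) (s t) 0 =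
    hess_form (f t) (x t) (block u t) (lam t.+1) (y t) (block v t)
    - (dot (lam t.+1) (s t.+1) - dot (lam t) (s t)).
  rewrite costate hess_formE // -/(dot (lam t.+1) _).
  rewrite {2}/s vhess_trajS // -/x -/l -/y -/(s t) dotDr.
  by ring.
rewrite (eq_bigr _ (fun t _ => step t)) sumrB.
rewrite -(big_mkord xpredT (fun t => dot (lam t.+1) (s t.+1) - dot (lam t) (s t))).
by rewrite telescope_sumr // s0 dot0 subr0 lamT lin_dot subrK.
Qed.

Lemma newton_objectiveE nu (lam : nat -> 'rV[R]_n_x) :
  lam tau = sgrad hT (x tau) ->
  (forall t : 'I_tau, (1 <= t)%N ->
     lam t = sgrad (fun z => h t z (block u t)) (x t)
             + lam t.+1 *m (grad (fun z => f t z (block u t)) (x t))^T) ->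
  newton_objective H g u nu v =
  lq_cost (fun t yt vt => quad2 (h t) (x t) (block u t) yt vt
      + 2^-1 * hess_form (f t) (x t) (block u t) (lam t.+1) yt vt
      + nu / 2 * sqnorm vt)
    (fun yT => quad hT (x tau) yT) y v.
Proof.
move=> lamT lamS.
rewrite lq_cost_sqnorm /newton_objective /quad; congr (_ + _).
have [_ -> ->] := cost_traj_expansion.
rewrite big_split [X in 2^-1 * X]addrACA (adjoint_sum lamT lamS) /=.
set Q := \sum_t hess_form _ _ _ _ _ _.
rewrite /lq_cost /quad2 /quad !big_split /= -!mulr_sumr -/Q /lin2.
by ring.
Qed.

End Objectives.

(** * Equivalence of the oracles with linear quadratic problems *)

Unset Implicit Arguments.
Set Strict Implicit.

Theorem lemma3p2 (R : realType) (tau n_x n_u : nat) (tau_ge1 : (1 <= tau)%N)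
    (f : 'I_tau -> 'rV[R]_n_x -> 'rV[R]_n_u -> 'rV[R]_n_x)
    (h : 'I_tau -> 'rV[R]_n_x -> 'rV[R]_n_u -> R)
    (hT : 'rV[R]_n_x -> R)
    (f_diff : forall t, twice_differentiable (joint (f t)))
    (h_diff : forall t, twice_differentiable_scalar (joint (h t)))
    (hT_diff : twice_differentiable_scalar hT)
    (x0 : 'rV[R]_n_x) (u : 'rV[R]_(tau * n_u)) :
  let H := joint (total_cost h hT x0) in
  let g := traj_ctrl f x0 in
  let x := traj f x0 u in
  let l := fun t : 'I_tau => vlin2 (f t) (x t) (block u t) in
  [/\ (* gradient oracle *)
      forall nu : R, 0 < nu -> forall v : 'rV[R]_(tau * n_u),
        is_argmin (gradient_objective H g u nu) v <->
        exists y : nat -> 'rV[R]_n_x,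
          lq_solution l
            (fun t yt vt =>
               lin2 (h t) (x t) (block u t) yt vt + nu / 2 * sqnorm vt)
            (fun yT => lin hT (x tau) yT)
            y v,
      (* Gauss-Newton oracle *)
      forall nu : R, 0 <= nu -> forall v : 'rV[R]_(tau * n_u),
        is_argmin (gauss_newton_objective H g u nu) v <->
        exists y : nat -> 'rV[R]_n_x,
          lq_solution l
            (fun t yt vt =>
               quad2 (h t) (x t) (block u t) yt vt + nu / 2 * sqnorm vt)
            (fun yT => quad hT (x tau) yT)
            y v
    & (* Newton oracle *)
      forall nu : R, 0 <= nu ->
      forall lam : nat -> 'rV[R]_n_x,
        lam tau = sgrad hT (x tau) ->
        (forall t : 'I_tau, (1 <= t)%N ->
           lam t = sgrad (fun z => h t z (block u t)) (x t)
                   + lam t.+1 *m (grad (fun z => f t z (block u t)) (x t))^T) ->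
      forall v : 'rV[R]_(tau * n_u),
        is_argmin (newton_objective H g u nu) v <->
        exists y : nat -> 'rV[R]_n_x,
          lq_solution l
            (fun t yt vt =>
               quad2 (h t) (x t) (block u t) yt vt
               + 2^-1 * hess_form (f t) (x t) (block u t) (lam t.+1) yt vt
               + nu / 2 * sqnorm vt)
            (fun yT => quad hT (x tau) yT)
            y v].
Proof.
move=> H g x l; split=> nu _.
- by move=> v; apply: argmin_lq_solution => w; exact: gradient_objectiveE.
- by move=> v; apply: argmin_lq_solution => w; exact: gauss_newton_objectiveE.
move=> lam lamT lamS v; apply: argmin_lq_solution => w.
exact: newton_objectiveE.
Qed.
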